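(* Let $\mathcal{H}$ be a complex Hilbert space, $T \in \mathcal{B}(\mathcal{H})$ and $q \in \mathbb{C}$ with $|q|\le 1$. Then \begin{equation*} \frac{|q|^2}{4} \|T^*T+TT^*\| \le w_q^2(T) \le \frac{2-|q|^2+2\sqrt{2}\,|q|\sqrt{1-|q|^2}}{2}\,\|TT^*+T^*T\|. \end{equation*}
   Context: $\mathcal{B}(\mathcal{H})$ is the $C^*$-algebra of all bounded linear operators on $\mathcal{H}$, with operator norm $\|\cdot\|$; the inner product is linear in its first argument. For $T\in\mathcal{B}(\mathcal{H})$ and $|q|\le 1$, the $q$-numerical radius is $w_q(T)=\sup\{|\langle Tx,y\rangle| : x,y\in\mathcal{H},\ \|x\|=\|y\|=1,\ \langle x,y\rangle=q\}$; it is understood that this set is nonempty, i.e. $\dim\mathcal{H}\ge 1$ if $|q|=1$ and $\dim\mathcal{H}\ge 2$ if $|q|<1$. Here $w_q^2(T)=(w_q(T))^2$. *)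

(* Defs.v *)
From HB Require Import structures.
From mathcomp Require Import all_boot all_order all_algebra.
From mathcomp Require Import sesquilinear complex.
From mathcomp Require Import boolp classical_sets reals topology normedtype.

Set Implicit Arguments.
Unset Strict Implicit.
Unset Printing Implicit Defensive.

Import Order.TTheory GRing.Theory Num.Theory.
Import numFieldNormedType.Exports.

Local Open Scope classical_set_scope.
Local Open Scope ring_scope.

(* In a [{dot H for conj}] form the first argument is the linear one. *)
HB.mixin Record CompleteNormedModule_isHilbert (R : realType) H
    of CompleteNormedModule R[i] H := {
  inner : {dot H for (Num.conj : R[i] -> R[i])} ;
  innerxx : forall x : H, inner x x = `|x| ^+ 2
}.

#[short(type="hilbertType")]
HB.structure Definition Hilbert (R : realType) :=
  {H of CompleteNormedModule R[i] H & CompleteNormedModule_isHilbert R H}.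

Section operators.
Context {R : realType}.

(* The norm of a normed module over [R[i]] takes its values in [R[i]], where
   they are nonnegative reals; [rnorm] is the same number as an element of
   [R], so that real suprema can be taken. *)
Definition rnorm (V : normedZmodType R[i]) (x : V) : R := complex.Re `|x|.

Context {H : hilbertType R}.
Implicit Types (T : H -> H) (q : R[i]).

Definition bounded_operator T : Prop :=
  exists M : R, forall x, rnorm (T x) <= M * rnorm x.

Definition opnorm T : R := sup [set rnorm (T x) | x in [set x | rnorm x <= 1]].

(* For [T] linear and bounded, the vector chosen exists by the Riesz
   representation theorem and is unique. *)
Definition adjoint T : H -> H :=
  fun y => xget 0 [set z | forall x, inner (T x) y = inner x z].

Definition qnumrange q T : set R[i] :=
  [set z | exists x y : H,
    [/\ rnorm x = 1, rnorm y = 1, inner x y = q & z = inner (T x) y]].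

Definition qnumradius q T : R := sup [set rnorm z | z in qnumrange q T].

End operators.

(* Main.v *)
Require Import Defs.
From mathcomp Require Import all_boot all_order all_algebra.
From mathcomp Require Import sesquilinear complex.
From mathcomp Require Import boolp classical_sets reals topology normedtype.
From mathcomp Require Import ring lra.

(** Write [T'] for the adjoint, [w] for the numerical radius of [T], [w_q] for
    its [q]-numerical radius and [N] for the norm of [T T' + T' T].

    Both bounds rest on one remark: for a unit vector [x], the unit vectors
    [y] with [inner x y = q] are exactly the [q^* x + z] with [z] orthogonal
    to [x] and [|z|^2 = 1 - |q|^2]; for these,
    [inner (T x) y = q * inner (T x) x + inner (T x) z].

    Lower bound.  Such a [z] exists because the [q]-numerical range is nonempty
    ([exists_orthogonal]); then [-z] is admissible too, and averaging the two
    values of [inner (T x) y] cancels the last term, so [|q| w <= w_q]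
    ([numradius_le_qnumradius]).  It remains to see that [N <= 4 w^2], an
    inequality due to Kittaneh ([rnorm_adjoint_comp_le]).  For unimodular [u]
    the operator [S_u = u T + u^* T'] is self-adjoint with quadratic form
    [2 Re (u * inner (T x) x)], so its norm is at most [2 w]; and
    [S_1^2 + S_i^2 = 2 (T T' + T' T)].

    Upper bound.  For a unit vector [x] one has [|T x|^2 + |T' x|^2 <= N].
    Hence [|T x| <= sqrt N], and [|inner (T x) x| <= sqrt (N / 2)] because the
    left-hand side is at most [|T x|] and at most [|T' x|].  Therefore
    [w_q <= |q| sqrt (N / 2) + sqrt (1 - |q|^2) sqrt N], whose square is the
    announced bound.

    The adjoint is a chosen vector, so its defining identity ([adjointP])
    requires the Riesz representation theorem ([Riesz_representation]).  The
    representing vector is obtained as the minimiser of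
    [|x|^2 - 2 Re (f x)]: the parallelogram law makes the sublevel sets of
    this functional shrink, and completeness provides the limit point. *)

Import Order.TTheory GRing.Theory Num.Theory.
Import numFieldNormedType.Exports.

Local Open Scope classical_set_scope.
Local Open Scope ring_scope.

(** * Norms and real parts of complex numbers *)

Section RealPart.
Local Open Scope complex_scope.
Context {R : realType}.

Lemma rnormE (V : normedZmodType R[i]) (x : V) : `|x| = (rnorm x)%:C.
Proof. by rewrite RRe_real// normr_real. Qed.

Lemma rnorm_ge0 (V : normedZmodType R[i]) (x : V) : 0 <= rnorm x.
Proof. by rewrite -ler0c -rnormE normr_ge0. Qed.

Lemma rnorm0_eq0 (V : normedZmodType R[i]) (x : V) : rnorm x = 0 -> x = 0.
Proof. by move=> x0; apply: normr0_eq0; rewrite rnormE x0. Qed.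

Lemma ler_rnormD (V : normedZmodType R[i]) (x y : V) :
  rnorm (x + y) <= rnorm x + rnorm y.
Proof. by rewrite -lecR rmorphD /= -!rnormE ler_normD. Qed.

Lemma rnormM (a b : R[i]) : rnorm (a * b) = rnorm a * rnorm b.
Proof. by apply: complexI; rewrite rmorphM /= -!rnormE normrM. Qed.

Lemma rnorm_real (t : R) : rnorm (t%:C) = `|t|.
Proof. by rewrite /rnorm normc_def /= expr0n addr0 sqrtr_sqr. Qed.

Lemma rnormC (a : R[i]) : rnorm a^*%C = rnorm a.
Proof. by rewrite /rnorm normcJ. Qed.

Lemma Re_le_rnorm (a : R[i]) : complex.Re a <= rnorm a.
Proof. by apply: le_trans (ler_norm _) _; rewrite -lecR -rnormE normc_ge_Re. Qed.

Lemma ReM_real (t : R) (a : R[i]) : complex.Re (t%:C * a) = t * complex.Re a.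
Proof. by case: a => a b /=; rewrite mul0r subr0. Qed.

Lemma ReD (a b : R[i]) : complex.Re (a + b) = complex.Re a + complex.Re b.
Proof. by case: a b => [a a'] [b b']. Qed.

Lemma ReN (a : R[i]) : complex.Re (- a) = - complex.Re a.
Proof. by case: a. Qed.

(** Turns a bound on all rotations of a real part into a bound on a modulus. *)
Lemma unimodular_polar (a : R[i]) :
  exists2 u : R[i], rnorm u = 1 & complex.Re (u * a) = rnorm a.
Proof.
have [->|a0] := eqVneq a 0.
  by exists 1; rewrite ?mulr0 /rnorm ?normr1 ?normr0.
have na0 : `|a| != 0 by rewrite normr_eq0.
exists (a^*%C / `|a|).
  by rewrite /rnorm normrM normcJ normrV ?unitfE// normr_id divff.
by rewrite mulrAC -[a^*%C * a]mulrC -sqr_normc expr2 mulfK.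
Qed.

End RealPart.

(** * The real part of the inner product *)

Section Inner.
Local Open Scope complex_scope.
Context {R : realType} {H : hilbertType R}.
Implicit Types (x y z : H) (a : R[i]).

Definition rinner x y : R := complex.Re (inner x y).

Lemma innerC x y : inner x y = (inner y x)^*%C.
Proof. by rewrite (hermC inner) expr0 mul1r. Qed.

Lemma innerDl x y z : inner (x + y) z = inner x z + inner y z.
Proof. exact: linearDl. Qed.

Lemma innerDr x y z : inner x (y + z) = inner x y + inner x z.
Proof. exact: linearDr. Qed.

Lemma innerNr x y : inner x (- y) = - inner x y.
Proof. exact: linearNr. Qed.

Lemma rinnerC x y : rinner x y = rinner y x.
Proof. by rewrite /rinner innerC; case: (inner y x). Qed.

Lemma rinnerDl x y z : rinner (x + y) z = rinner x z + rinner y z.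
Proof. by rewrite /rinner innerDl ReD. Qed.

Lemma rinnerDr x y z : rinner x (y + z) = rinner x y + rinner x z.
Proof. by rewrite rinnerC rinnerDl !(rinnerC x). Qed.

Lemma rinnerNl x y : rinner (- x) y = - rinner x y.
Proof. by rewrite /rinner linearNl ReN. Qed.

Lemma rinnerNr x y : rinner x (- y) = - rinner x y.
Proof. by rewrite rinnerC rinnerNl rinnerC. Qed.

Lemma innerZl a x y : inner (a *: x) y = a * inner x y.
Proof. by rewrite linearZl_LR. Qed.

Lemma innerZr a x y : inner x (a *: y) = a^*%C * inner x y.
Proof. by rewrite innerC innerZl rmorphM /= -innerC. Qed.

Lemma rinnerZl (t : R) x y : rinner (t%:C *: x) y = t * rinner x y.
Proof. by rewrite /rinner innerZl ReM_real. Qed.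

Lemma rinnerZr (t : R) x y : rinner x (t%:C *: y) = t * rinner x y.
Proof. by rewrite rinnerC rinnerZl rinnerC. Qed.

Definition rinnerE := (rinnerDl, rinnerDr, rinnerNl, rinnerNr, rinnerZl, rinnerZr).

Lemma rinnerxx x : rinner x x = rnorm x ^+ 2.
Proof. by rewrite /rinner innerxx rnormE -rmorphXn. Qed.

Lemma rnormZ a x : rnorm (a *: x) = rnorm a * rnorm x.
Proof. by apply: complexI; rewrite rmorphM /= -!rnormE normrZ. Qed.

Lemma rnormN x : rnorm (- x) = rnorm x.
Proof. by rewrite /rnorm normrN. Qed.

Lemma parallelogram x y :
  rnorm (x + y) ^+ 2 + rnorm (x - y) ^+ 2 = 2 * rnorm x ^+ 2 + 2 * rnorm y ^+ 2.
Proof. rewrite -!rinnerxx !rinnerE (rinnerC y x); ring. Qed.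

(** Real Cauchy-Schwarz: expand the squared norm of [|y| x - |x| y] and divide
    by [2 |x| |y|]. *)
Lemma rinner_le x y : rinner x y <= rnorm x * rnorm y.
Proof.
have [x0|x0] := eqVneq (rnorm x) 0.
  by rewrite x0 (rnorm0_eq0 _ _ x0) /rinner linear0l mul0r.
have [y0|y0] := eqVneq (rnorm y) 0.
  by rewrite y0 (rnorm0_eq0 _ _ y0) /rinner linear0r mulr0.
have xy0 : 0 < rnorm x * rnorm y.
  by rewrite mulr_gt0// lt_def rnorm_ge0 ?x0 ?y0.
rewrite -(ler_pM2l xy0).
have := sqr_ge0 (rnorm ((rnorm y)%:C *: x - (rnorm x)%:C *: y)).
rewrite -rinnerxx !rinnerE !rinnerxx (rinnerC y x).
nra.
Qed.

(** Rotating [x] by a unimodular scalar makes [inner x y] a nonnegative real,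
    which reduces the claim to the real inequality. *)
Lemma CauchySchwarz_inner x y : rnorm (inner x y) <= rnorm x * rnorm y.
Proof.
have [u u1 <-] := unimodular_polar (inner x y).
by rewrite -innerZl (le_trans (rinner_le _ _))// rnormZ u1 mul1r.
Qed.

End Inner.

(** * The Riesz representation theorem *)

Section Riesz.
Local Open Scope complex_scope.
Context {R : realType} {H : hilbertType R}.
Implicit Types (x y z : H).

(** This is how completeness enters.  By [close], the sublevel sets of [J]
    just above [m] have arbitrarily small diameter, so the filter that they
    generate is Cauchy; [z] is its limit. *)
Lemma cvg_of_small_sublevels (J : H -> R) (m : R) :
    (forall e : R, 0 < e -> exists x, J x < m + e) ->
    (forall x y, rnorm (x - y) ^+ 2 <= 2 * (J x - m) + 2 * (J y - m)) ->
  exists z, forall e : R, 0 < e -> exists2 x, J x < m + e & rnorm (z - x) < e.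
Proof.
move=> inhab close.
pose F := filter_from [set e : R | 0 < e] (fun e => [set x | J x < m + e]).
have FF : ProperFilter F.
  apply: filter_from_proper; last by move=> e /inhab.
  apply: filter_from_filter; first by exists 1; rewrite /= ltr01.
  move=> d e /= d0 e0; exists (Num.min d e); first by rewrite lt_min d0.
  by move=> x /=; rewrite -ltrBlDl lt_min !ltrBlDl => /andP[].
have cF : cauchy F.
  apply: cauchy_exP => e e0.
  have eE : e = (complex.Re e)%:C by rewrite RRe_real// gtr0_real.
  have r0 : 0 < complex.Re e by rewrite -ltcR -eE.
  set r := complex.Re e in r0 eE.
  have d0 : 0 < r ^+ 2 / 4 by rewrite divr_gt0// exprn_gt0.
  have [x Jx] := inhab _ d0.
  exists x, (r ^+ 2 / 4) => //= y /= Jy.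
  rewrite -ball_normE /= rnormE eE ltcR.
  rewrite -(@ltr_pXn2r _ 2)// ?nnegrE ?rnorm_ge0 ?ltW//.
  by have := close x y; lra.
have := cauchy_cvg F cF; set z := lim F => Fz.
exists z => e e0.
have /Fz [d /= d0 sub] : nbhs z (ball z (e%:C)).
  by apply: nbhsx_ballx; rewrite ltcR.
have me0 : 0 < Num.min d e by rewrite lt_min d0.
have [x Jx] := inhab _ me0.
have [Jd Je] : J x < m + d /\ J x < m + e.
  by move: Jx; rewrite -ltrBlDl lt_min !ltrBlDl => /andP[].
exists x => //.
by have := sub _ Jd; rewrite -ball_normE /= rnormE ltcR.
Qed.

(** Here [z] is the limit of near-minimisers of [J x = |x|^2 - 2 Re (f x)].
    Perturbing a near-minimiser along a small multiple of [x] shows that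
    [Re (f x) <= rinner x z]; applying this to [- x] gives equality, and to
    ['i x] the imaginary parts. *)
Lemma Riesz_representation (f : H -> R[i]) (M : R) :
    scalar f -> (forall x, rnorm (f x) <= M * rnorm x) ->
  exists z, forall x, f x = inner x z.
Proof.
move=> flin fM.
have fD x y : f (x + y) = f x + f y by have := flin 1 x y; rewrite scale1r mul1r.
have f0 : f 0 = 0 by apply: (addrI (f 0)); rewrite -fD !addr0.
have fZ a x : f (a *: x) = a * f x by have := flin a x 0; rewrite !addr0 f0 addr0.
pose g x := complex.Re (f x).
have gD x y : g (x + y) = g x + g y by rewrite /g fD ReD.
have gZ (t : R) x : g (t%:C *: x) = t * g x by rewrite /g fZ ReM_real.
have gM x : g x <= M * rnorm x by apply: le_trans (fM x); exact: Re_le_rnorm.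
pose J x := rnorm x ^+ 2 - 2 * g x.
pose m := inf (range J).
have infJ : has_inf (range J).
  split; first by exists (J 0), 0.
  exists (- M ^+ 2) => _ [x _ <-]; rewrite /J.
  by have := gM x; have := sqr_ge0 (rnorm x - M); nra.
have Jm x : m <= J x by apply: ge_inf; [case: infJ|exists x].
have [] := @cvg_of_small_sublevels J m.
- by move=> e e0; have [_ [x _ <-] lt] := inf_adherent e0 infJ; exists x.
- move=> x y.
  have := Jm ((2^-1)%:C *: (x + y)); rewrite /J -!rinnerxx gZ gD !rinnerE.
  by rewrite (rinnerC y x); lra.
move=> z hz.
(* Minimality along u + t x, with u within t^2 of both the infimum and z,
   gives 2 t (g x - rinner x z) <= t^2 C; the choice of t makes this at most
   2 t e, and t <= 1 lets t^2 bound the error terms. *)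
have le x : g x <= rinner x z.
  apply/ler_addgt0Pr => e e0.
  pose C := 1 + rnorm x ^+ 2 + 2 * rnorm x.
  have C0 : 0 < C by rewrite /C; have := rnorm_ge0 _ x; have := sqr_ge0 (rnorm x); lra.
  have t0 : 0 < Num.min 1 (2 * e / C).
    by rewrite lt_min ltr01 divr_gt0// mulr_gt0.
  set t := Num.min _ _ in t0.
  have tC : t * C <= 2 * e by rewrite -ler_pdivlMr// ge_min lexx orbT.
  have tt0 : 0 < t ^+ 2 by rewrite exprn_gt0.
  have t1 : t <= 1 by rewrite ge_min lexx.
  have t2t : t ^+ 2 <= t by rewrite expr2 ger_pMl.
  have [u Ju uz] := hz _ tt0.
  have := Jm (u + t%:C *: x); rewrite /J -rinnerxx gD gZ !rinnerE !rinnerxx.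
  have := rinner_le x (u - z); rewrite !rinnerE -[u - z]opprB rnormN.
  rewrite (rinnerC u x) /J in Ju *; move: Ju uz (rnorm_ge0 _ x) tC; rewrite /C.
  set a := rnorm x; set b := rnorm (z - u); set c := rinner x u.
  set d := rinner x z; set G := g x.
  move=> Ju bt a0 tC cs Jmin.
  have ab : a * b <= a * t by apply: ler_wpM2l => //; apply: le_trans t2t; exact: ltW.
  have : t * (2 * (G - c)) <= t * (t * (1 + a ^+ 2)) by nra.
  by rewrite ler_pM2l// => h; nra.
have eqR x : g x = rinner x z.
  apply/eqP; rewrite eq_le le/= -lerN2 -rinnerNl -[X in - X]mul1r -mulNr.
  rewrite -gZ rmorphN1 scaleN1r; exact: le.
exists z => x.
have eqI : complex.Re ('i%C * f x) = complex.Re ('i%C * inner x z).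
  by rewrite -fZ -innerZl -/(g _) eqR.
move: (eqR x) eqI; rewrite /g /rinner.
case: (f x) => a b; case: (inner x z) => c d /= -> /eqP.
by rewrite !mul0r !mul1r !sub0r eqr_opp => /eqP ->.
Qed.

End Riesz.

(** * The adjoint of a bounded operator *)

Section Adjoint.
Local Open Scope complex_scope.
Context {R : realType} {H : hilbertType R}.
Variable (T : {linear H -> H}).
Hypothesis T_bounded : bounded_operator T.
Implicit Types (x y z : H).

Lemma bounded_operator_ge0 :
  exists2 M : R, 0 <= M & forall x, rnorm (T x) <= M * rnorm x.
Proof.
have [M TM] := T_bounded; exists `|M| => // x.
by apply: le_trans (TM x) _; rewrite ler_wpM2r ?rnorm_ge0 ?ler_norm.
Qed.

Lemma adjointP x y : inner (T x) y = inner x (adjoint T y).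
Proof.
have [M M0 TM] := bounded_operator_ge0.
have [|v|z fz] := @Riesz_representation _ H (fun x => inner (T x) y) (M * rnorm y).
- by move=> a u v; rewrite linearP innerDl innerZl.
- rewrite mulrAC (le_trans (CauchySchwarz_inner _ _))//.
  by rewrite ler_wpM2r ?rnorm_ge0.
by rewrite /adjoint; case: xgetP => [w _ /(_ x)//|/(_ z)]; case.
Qed.

Lemma adjointPr x y : inner (adjoint T x) y = inner x (T y).
Proof. by rewrite innerC -adjointP -innerC. Qed.

(** From [|T' x|^2 = Re (inner (T (T' x)) x) <= M |T' x| |x|]. *)
Lemma rnorm_adjoint_le (M : R) : 0 <= M ->
    (forall x, rnorm (T x) <= M * rnorm x) ->
  forall x, rnorm (adjoint T x) <= M * rnorm x.
Proof.
move=> M0 TM x; have := rinner_le (T (adjoint T x)) x.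
rewrite /rinner adjointP -/(rinner _ _) rinnerxx => nle.
have := ler_wpM2r (rnorm_ge0 _ x) (TM (adjoint T x)).
have := rnorm_ge0 _ (adjoint T x); rewrite le_eqVlt => /predU1P[<- _|n0].
  by rewrite mulr_ge0 ?rnorm_ge0.
by move/(le_trans nle); rewrite expr2 mulrAC mulrC ler_pM2r.
Qed.
End Adjoint.

(** * Operator norm and numerical radius *)

Section Operator.
Local Open Scope complex_scope.
Context {R : realType} {H : hilbertType R}.
Implicit Types (x y z : H).

Lemma has_ubound_opnorm (S : H -> H) : bounded_operator S ->
  has_ubound [set rnorm (S x) | x in [set x | rnorm x <= 1]].
Proof.
move=> [M SM]; exists `|M| => _ [x /= x1 <-]; apply: le_trans (SM x) _.
apply: le_trans (ler_wpM2r (rnorm_ge0 _ x) (ler_norm M)) _.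
by rewrite ler_piMr.
Qed.

Lemma rnorm_le_opnorm (S : H -> H) x :
  bounded_operator S -> rnorm x <= 1 -> rnorm (S x) <= opnorm S.
Proof. by move=> /has_ubound_opnorm/ub_le_sup ub x1; apply: ub; exists x. Qed.

Lemma opnorm_le (S : H -> H) (c : R) : 0 <= c ->
  (forall x, rnorm (S x) <= c * rnorm x) -> opnorm S <= c.
Proof.
move=> c0 Sc; apply: ge_sup.
  by exists (rnorm (S 0)), 0; rewrite //= /rnorm normr0.
by move=> _ [x /= x1 <-]; apply: le_trans (Sc x) _; rewrite ler_piMr.
Qed.

(** A symmetric operator is controlled by its quadratic form.  By polarization
    and the parallelogram law,
    [2 Re (inner (S x) y) <= c (|x|^2 + |y|^2)]; then take [y = c^-1 S x].
    Symmetry replaces linearity of [S], as it lets each application of [S] be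
    moved to the argument that is not a sum. *)
Lemma symmetric_rnorm_le (S : H -> H) (c : R) : 0 <= c ->
    (forall x y, inner (S x) y = inner x (S y)) ->
    (forall x, `|rinner (S x) x| <= c * rnorm x ^+ 2) ->
  forall x, rnorm (S x) <= c * rnorm x.
Proof.
move=> c0 Ssym Sc x.
have rS u v : rinner (S u) v = rinner u (S v) by rewrite /rinner Ssym.
have polar y : 2 * rinner (S x) y <= c * (rnorm x ^+ 2 + rnorm y ^+ 2).
  have := Sc (x + y); have := Sc (x - y); rewrite !ler_norml => /andP[+ _] /andP[_].
  rewrite !rS !rinnerDl !rinnerNl -!rS !rinnerDr !rinnerNr.
  rewrite (rS y) (rinnerC y (S x)).
  have := parallelogram x y; nra.
have Sx y (t : R) : 2 * (t * rinner (S x) y) <= c * (rnorm x ^+ 2 + t ^+ 2 * rnorm y ^+ 2).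
  by have := polar (t%:C *: y); rewrite rinnerZr rnormZ rnorm_real exprMn real_normK ?num_real.
rewrite -(@ler_pXn2r _ 2)// ?nnegrE ?mulr_ge0 ?rnorm_ge0// exprMn.
(* When c = 0 the multiple c^-1 is not available, but y = S x will do. *)
move: c0; rewrite le_eqVlt => /predU1P[c0|c0].
  by have := Sx (S x) 1; rewrite rinnerxx -c0; lra.
have := ler_wpM2l (ltW c0) (Sx (S x) c^-1).
have -> : c * (2 * (c^-1 * rinner (S x) (S x))) = 2 * rnorm (S x) ^+ 2.
  by rewrite rinnerxx; field; rewrite gt_eqF.
have -> : c * (c * (rnorm x ^+ 2 + c^-1 ^+ 2 * rnorm (S x) ^+ 2)) =
          c ^+ 2 * rnorm x ^+ 2 + rnorm (S x) ^+ 2.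
  by field; rewrite gt_eqF.
lra.
Qed.

Variable T : {linear H -> H}.
Hypothesis T_bounded : bounded_operator T.

Local Notation adjT := (adjoint T).

Lemma bounded_adjoint_comp :
  bounded_operator ((T \o adjT) \+ (adjT \o T)).
Proof.
have [M M0 TM] := bounded_operator_ge0 _ T_bounded.
have AM := rnorm_adjoint_le _ T_bounded _ M0 TM.
exists (M * M + M * M) => x /=; apply: le_trans (ler_rnormD _ _ _) _.
rewrite mulrDl -!mulrA lerD//.
  by apply: le_trans (TM _) _; rewrite ler_wpM2l.
by apply: le_trans (AM _) _; rewrite ler_wpM2l.
Qed.

(** Twice the real part of the operator [u T]. *)
Definition rotated_real_part (u : R[i]) x := u *: T x + u^*%C *: adjT x.

Lemma rotated_real_part_sym u x y :
  inner (rotated_real_part u x) y = inner x (rotated_real_part u y).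
Proof.
rewrite /rotated_real_part innerDl innerDr !innerZl !innerZr.
by rewrite conjcK (adjointP _ T_bounded) (adjointPr _ T_bounded) addrC.
Qed.

Lemma rnorm_rotated_real_part_le (w : R) (u : R[i]) : 0 <= w -> rnorm u = 1 ->
    (forall x, rnorm (inner (T x) x) <= w * rnorm x ^+ 2) ->
  forall x, rnorm (rotated_real_part u x) <= 2 * w * rnorm x.
Proof.
move=> w0 u1 Tw; apply: symmetric_rnorm_le; rewrite ?mulr_ge0//.
  exact: rotated_real_part_sym.
move=> x; rewrite /rinner /rotated_real_part innerDl !innerZl.
rewrite (adjointPr _ T_bounded) (innerC x) -rmorphM /=.
have -> (a : R[i]) : complex.Re (a + a^*%C) = 2 * complex.Re a.
  by case: a => a b /=; lra.
rewrite normrM ger0_norm// -mulrA ler_pM2l// -rnorm_real.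
apply: le_trans (Tw x); rewrite -[rnorm (inner _ _)]mul1r -u1 -rnormM.
by rewrite rnorm_real -lecR -rnormE normc_ge_Re.
Qed.

(** Kittaneh's inequality.  With [S_u = u T + u^* T'] and
    [z = T' T x + T T' x], the identity [S_1^2 + S_i^2 = 2 (T' T + T T')] is
    used in the weak form
    [2 |z|^2 = rinner (S_1 x) (S_1 z) + rinner (S_i x) (S_i z)], where the
    adjoint is never applied to a sum. *)
Lemma rnorm_adjoint_comp_le (w : R) : 0 <= w ->
    (forall x, rnorm (inner (T x) x) <= w * rnorm x ^+ 2) ->
  forall x, rnorm (((adjT \o T) \+ (T \o adjT)) x) <= 4 * w ^+ 2 * rnorm x.
Proof.
move=> w0 Tw x; set z := _ x.
have i1 : rnorm ('i%C : R[i]) = 1.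
  by rewrite /rnorm normc_def /= expr0n expr1n add0r sqrtr1.
have o1 : rnorm (1 : R[i]) = 1 by rewrite /rnorm normr1.
have S1 := rnorm_rotated_real_part_le _ _ w0 o1 Tw.
have Si := rnorm_rotated_real_part_le _ _ w0 i1 Tw.
have zz : 2 * rnorm z ^+ 2 =
    rinner (rotated_real_part 1 x) (rotated_real_part 1 z) +
    rinner (rotated_real_part 'i%C x) (rotated_real_part 'i%C z).
  rewrite -rinnerxx /rinner {1}/z /= innerDl adjointP// adjointPr//.
  rewrite /rotated_real_part !innerDl !innerDr !innerZl !innerZr.
  rewrite -!ReD rmorph1 conjcK.
  move: (inner (T x) (T z)) (inner (adjT x) (adjT z)) (inner (T x) (adjT z)) (inner (adjT x) (T z)).
  by move=> [a a'] [b b'] [c c'] [d d'] /=; ring.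
have h : 2 * rnorm z ^+ 2 <= 2 * (4 * w ^+ 2 * rnorm x * rnorm z).
  have prod u : rnorm (rotated_real_part u x) <= 2 * w * rnorm x ->
     rnorm (rotated_real_part u z) <= 2 * w * rnorm z ->
     rinner (rotated_real_part u x) (rotated_real_part u z) <= 4 * w ^+ 2 * rnorm x * rnorm z.
    move=> h1 h2; apply: le_trans (rinner_le _ _) _.
    have -> : 4 * w ^+ 2 * rnorm x * rnorm z = (2 * w * rnorm x) * (2 * w * rnorm z) by ring.
    by apply: ler_pM; rewrite ?rnorm_ge0.
  by rewrite zz mulr2n mulrDl !mul1r lerD// prod.
have := rnorm_ge0 _ z; rewrite le_eqVlt => /predU1P[<-|z0].
  by rewrite !mulr_ge0 ?sqr_ge0 ?rnorm_ge0.
by move: h; rewrite ler_pM2l// expr2 ler_pM2r.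
Qed.

(** The left-hand side is the quadratic form of [T T' + T' T] at [x]. *)
Lemma sqr_rnorm_add_adjoint_le x : rnorm x = 1 ->
  rnorm (T x) ^+ 2 + rnorm (adjT x) ^+ 2 <= opnorm ((T \o adjT) \+ (adjT \o T)).
Proof.
move=> x1.
have x1' : rnorm x <= 1 by rewrite x1.
apply: le_trans (rnorm_le_opnorm _ _ bounded_adjoint_comp x1').
have := rinner_le (((T \o adjT) \+ (adjT \o T)) x) x; rewrite x1 mulr1 => h.
apply: le_trans h; rewrite -!rinnerxx /rinner /= innerDl.
by rewrite (adjointP _ _ (adjT x))// (adjointPr _ _ (T x))// ReD addrC.
Qed.

(** By Cauchy-Schwarz [|inner (T x) x|] is at most [|T x|], and also at most
    [|T' x|] once [T] is moved to the other side. *)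
Lemma sqr_rnorm_inner_le x : rnorm x = 1 ->
  2 * rnorm (inner (T x) x) ^+ 2 <= opnorm ((T \o adjT) \+ (adjT \o T)).
Proof.
move=> x1; apply: le_trans (sqr_rnorm_add_adjoint_le _ x1).
have h1 : rnorm (inner (T x) x) <= rnorm (T x).
  by apply: le_trans (CauchySchwarz_inner _ _) _; rewrite x1 mulr1.
have h2 : rnorm (inner (T x) x) <= rnorm (adjT x).
  rewrite adjointP//.
  by apply: le_trans (CauchySchwarz_inner _ _) _; rewrite x1 mul1r.
rewrite mulr2n mulrDl mul1r lerD// lerXn2r// ?nnegrE ?rnorm_ge0//.
Qed.

End Operator.

(** * The q-numerical radius *)

Section QNumericalRadius.
Local Open Scope complex_scope.
Context {R : realType} {H : hilbertType R}.
Variable T : {linear H -> H}.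
Hypothesis T_bounded : bounded_operator T.
Variable q : R[i].
Hypothesis q_le1 : rnorm q <= 1.
Implicit Types (x y z : H).

Lemma orthogonal_decomposition x z : rnorm x = 1 -> inner x z = 0 ->
  inner x (q^*%C *: x + z) = q /\
  rnorm (q^*%C *: x + z) ^+ 2 = rnorm q ^+ 2 + rnorm z ^+ 2.
Proof.
move=> x1 xz.
have xx : inner x x = 1 by rewrite innerxx rnormE x1 expr1n.
split; first by rewrite innerDr innerZr conjcK xx mulr1 xz addr0.
rewrite -[LHS]rinnerxx rinnerDl !rinnerDr !rinnerxx rnormZ rnormC x1 mulr1.
by rewrite (rinnerC z) /rinner innerZl xz mulr0 /=; ring.
Qed.

Lemma orthogonal_remainder x y : rnorm x = 1 -> rnorm y = 1 -> inner x y = q ->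
  let z := y - q^*%C *: x in
  [/\ y = q^*%C *: x + z, inner x z = 0 & rnorm z ^+ 2 = 1 - rnorm q ^+ 2].
Proof.
move=> x1 y1 xyq z.
have xx : inner x x = 1 by rewrite innerxx rnormE x1 expr1n.
have yE : y = q^*%C *: x + z by rewrite addrC subrK.
have xz : inner x z = 0 by rewrite innerDr innerNr innerZr conjcK xx mulr1 xyq subrr.
split=> //; have [_] := orthogonal_decomposition _ _ x1 xz.
by rewrite -yE y1; lra.
Qed.

(** When [|q| < 1] this needs a vector independent of [x].  If there were none,
    the two vectors that witness a point of the [q]-numerical range would be
    unimodular multiples of [x], so that [|q| = 1], and then [z = 0] works. *)
Lemma exists_orthogonal x : qnumrange q T !=set0 -> rnorm x = 1 ->
  exists2 z : H, inner x z = 0 & rnorm z ^+ 2 = 1 - rnorm q ^+ 2.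
Proof.
move=> [_ [a [b [a1 b1 abq _]]]] x1.
have xx : inner x x = 1 by rewrite innerxx rnormE x1 expr1n.
pose p v := v - inner v x *: x.
have xp v : inner x (p v) = 0.
  by rewrite innerDr innerNr innerZr xx mulr1 -innerC subrr.
have s0 : 0 <= 1 - rnorm q ^+ 2 by rewrite subr_ge0 expr_le1// rnorm_ge0.
have [[v pv0]|p0] := pselect (exists v, p v != 0).
  have n0 : rnorm (p v) != 0 by apply: contra_neq pv0; exact: rnorm0_eq0.
  exists ((Num.sqrt (1 - rnorm q ^+ 2) / rnorm (p v))%:C *: p v).
    by rewrite innerZr xp mulr0.
  rewrite rnormZ rnorm_real ger0_norm ?divr_ge0 ?sqrtr_ge0 ?rnorm_ge0//.
  by rewrite divfK// sqr_sqrtr.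
have pE v : v = inner v x *: x.
  by apply/subr0_eq/eqP; apply: contra_notT p0 => ?; exists v.
exists 0; first by rewrite linear0r.
have c1 v : rnorm v = 1 -> rnorm (inner v x) = 1.
  by move=> v1; rewrite -[RHS]v1 [in RHS](pE v) rnormZ x1 mulr1.
rewrite -abq (pE a) (pE b) innerZl innerZr xx mulr1 rnormM rnormC !c1//.
by rewrite /rnorm normr0 /= mulr1 expr1n subrr expr0n.
Qed.

Lemma rnorm_inner_le_qnumradius x y : rnorm x = 1 -> rnorm y = 1 ->
  inner x y = q -> rnorm (inner (T x) y) <= qnumradius q T.
Proof.
move=> x1 y1 xyq.
have [M TM] := T_bounded.
apply: ub_le_sup; last by exists (inner (T x) y) => //; exists x, y.
exists M => _ [_ [a [b [a1 b1 _ ->]]] <-].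
apply: le_trans (CauchySchwarz_inner _ _) _; rewrite b1 mulr1.
by have := TM a; rewrite a1 mulr1.
Qed.

Lemma qnumradius_ge0 : qnumrange q T !=set0 -> 0 <= qnumradius q T.
Proof.
move=> [_ [x [y [x1 y1 xyq _]]]].
by apply: le_trans (rnorm_inner_le_qnumradius _ _ x1 y1 xyq); rewrite rnorm_ge0.
Qed.

(** The vectors [q^* x + z] and [q^* x - z] both compete in the supremum, and
    the sum of the two values is [2 q * inner (T x) x]. *)
Lemma numradius_le_qnumradius x : qnumrange q T !=set0 -> rnorm x = 1 ->
  rnorm q * rnorm (inner (T x) x) <= qnumradius q T.
Proof.
move=> ne x1.
have [z xz zn] := exists_orthogonal _ ne x1.
have W z' : inner x z' = 0 -> rnorm z' ^+ 2 = 1 - rnorm q ^+ 2 ->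
    rnorm (q * inner (T x) x + inner (T x) z') <= qnumradius q T.
  move=> xz' zn'; have [xyq yn] := orthogonal_decomposition _ _ x1 xz'.
  rewrite -[q in q * _]conjcK -innerZr -innerDr.
  apply: rnorm_inner_le_qnumradius => //.
  by apply/eqP; rewrite -(@eqrXn2 _ 2)// ?rnorm_ge0// yn zn' expr1n subrKC.
have Wp := W _ xz zn.
have Wm : rnorm (q * inner (T x) x - inner (T x) z) <= qnumradius q T.
  by rewrite -innerNr W ?rnormN// innerNr xz oppr0.
rewrite -rnormM -(@ler_pM2l _ 2)//.
have -> : 2 * rnorm (q * inner (T x) x) = rnorm (2%:R * (q * inner (T x) x)).
  rewrite [RHS]rnormM; congr (_ * _); apply: complexI.
  by rewrite -rnormE normr_nat rmorph_nat.
have -> : 2%:R * (q * inner (T x) x) = (q * inner (T x) x + inner (T x) z) + (q * inner (T x) x - inner (T x) z) by ring.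
by apply: le_trans (ler_rnormD _ _ _) _; rewrite mulr2n mulrDl mul1r lerD.
Qed.

Lemma qnumradius_lower_bound : qnumrange q T !=set0 ->
  rnorm q ^+ 2 / 4 * opnorm ((adjoint T \o T) \+ (T \o adjoint T))
    <= qnumradius q T ^+ 2.
Proof.
move=> ne; have W0 := qnumradius_ge0 ne.
have := rnorm_ge0 _ q; rewrite le_eqVlt => /predU1P[<-|q0].
  by rewrite expr0n !mul0r sqr_ge0.
set w := qnumradius q T / rnorm q.
have w0 : 0 <= w by rewrite divr_ge0// ltW.
have Tw x : rnorm (inner (T x) x) <= w * rnorm x ^+ 2.
  have [n0|n0] := eqVneq (rnorm x) 0.
    rewrite n0 (rnorm0_eq0 _ _ n0) linear0r /rnorm normr0 /=.
    by rewrite expr0n mulr0.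
  pose e := ((rnorm x)^-1)%:C *: x.
  have e1 : rnorm e = 1.
    by rewrite rnormZ rnorm_real ger0_norm ?invr_ge0 ?rnorm_ge0// mulVf.
  have xE : x = (rnorm x)%:C *: e by rewrite scalerA -rmorphM mulfV// scale1r.
  have := numradius_le_qnumradius _ ne e1.
  rewrite mulrC -ler_pdivlMr// -/w => we.
  have TE : T x = (rnorm x)%:C *: T e by rewrite [in LHS]xE linearZ.
  rewrite TE [in X in inner _ X]xE innerZl innerZr conjc_real !rnormM.
  rewrite rnorm_real ger0_norm ?rnorm_ge0//.
  by rewrite mulrA -expr2 mulrC ler_wpM2r ?sqr_ge0.
have N := opnorm_le _ _ _ (rnorm_adjoint_comp_le _ T_bounded _ w0 Tw).
have -> : qnumradius q T ^+ 2 = rnorm q ^+ 2 / 4 * (4 * w ^+ 2).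
  by rewrite /w; field; rewrite gt_eqF.
by rewrite ler_wpM2l ?divr_ge0 ?sqr_ge0// N// mulr_ge0 ?sqr_ge0.
Qed.

Lemma qnumradius_upper_bound : qnumrange q T !=set0 ->
  qnumradius q T ^+ 2
    <= (2 - rnorm q ^+ 2
          + 2 * Num.sqrt 2 * rnorm q * Num.sqrt (1 - rnorm q ^+ 2)) / 2
       * opnorm ((T \o adjoint T) \+ (adjoint T \o T)).
Proof.
move=> ne; have W0 := qnumradius_ge0 ne.
have q0 := rnorm_ge0 _ q.
set N := opnorm _; set s := Num.sqrt (1 - _).
have s0 : 0 <= s by rewrite sqrtr_ge0.
have ss : s ^+ 2 = 1 - rnorm q ^+ 2 by rewrite sqr_sqrtr// subr_ge0 expr_le1.
have N0 : 0 <= N.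
  have [_ [x [_ [x1 _ _ _]]]] := ne.
  apply: le_trans (sqr_rnorm_inner_le _ T_bounded _ x1).
  by rewrite mulr_ge0 ?sqr_ge0.
set h := Num.sqrt 2.
have h0 : 0 < h by rewrite sqrtr_gt0.
have hh : h ^+ 2 = 2 by rewrite sqr_sqrtr.
set n := Num.sqrt N.
have n0 : 0 <= n by rewrite sqrtr_ge0.
have nn : n ^+ 2 = N by rewrite sqr_sqrtr.
(* h / 2 is the inverse of the square root of 2, so h / 2 * n is the square
   root of N / 2. *)
have Wle : qnumradius q T <= (rnorm q * (h / 2) + s) * n.
  apply: ge_sup; first by case: ne => z; exists (rnorm z), z.
  move=> _ [_ [x [y [x1 y1 xyq ->]]] <-].
  have [yE xz zn] := orthogonal_remainder _ _ x1 y1 xyq.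
  rewrite yE innerDr innerZr conjcK.
  apply: le_trans (ler_rnormD _ _ _) _; rewrite rnormM mulrDl lerD//.
    rewrite -mulrA ler_wpM2l// -(@ler_pXn2r _ 2)// ?nnegrE ?rnorm_ge0 ?mulr_ge0 ?invr_ge0 ?(ltW h0)//.
    rewrite !exprMn hh nn.
    by have := sqr_rnorm_inner_le _ T_bounded _ x1; rewrite -/N; lra.
  apply: le_trans (CauchySchwarz_inner _ _) _; rewrite mulrC ler_pM ?rnorm_ge0//.
    by rewrite -(@ler_pXn2r _ 2)// ?nnegrE ?rnorm_ge0// zn ss.
  rewrite -(@ler_pXn2r _ 2)// ?nnegrE ?rnorm_ge0// nn.
  apply: le_trans (sqr_rnorm_add_adjoint_le _ T_bounded _ x1).
  by rewrite lerDl sqr_ge0.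
rewrite -nn.
apply: (@le_trans _ _ (((rnorm q * (h / 2) + s) * n) ^+ 2)).
  by rewrite lerXn2r// nnegrE (le_trans W0).
rewrite exprMn ler_wpM2r ?sqr_ge0// sqrrD ss !exprMn hh.
lra.
Qed.

End QNumericalRadius.

Theorem corollary3p1 (R : realType) (H : hilbertType R)
    (T : {linear H -> H}) (T_bounded : bounded_operator T)
    (q : R[i]) (q_le1 : rnorm q <= 1) (qW_neq0 : qnumrange q T !=set0) :
  rnorm q ^+ 2 / 4 * opnorm ((adjoint T \o T) \+ (T \o adjoint T))
    <= qnumradius q T ^+ 2
  /\
  qnumradius q T ^+ 2
    <= (2 - rnorm q ^+ 2
          + 2 * Num.sqrt 2 * rnorm q * Num.sqrt (1 - rnorm q ^+ 2)) / 2
       * opnorm ((T \o adjoint T) \+ (adjoint T \o T)).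
Proof.
split; [exact: qnumradius_lower_bound|exact: qnumradius_upper_bound].
Qed.
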